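(* Let $1\le p\le\infty$ and $1/p+1/q=1$. Suppose that all solutions $u=(u_j)_{j\ge-1}$ of $$A_{j,j-1}u_{j-1}+A_{j,j}u_j+A_{j,j+1}u_{j+1}=0,\qquad j\ge 0,$$ belong to $l_n^p$, and all solutions $v=(v_j)_{j\ge-1}$ of $$v_{j-1}^{*}A_{j-1,j}+v_j^{*}A_{j,j}+v_{j+1}^{*}A_{j+1,j}=0,\qquad j\ge 0,$$ belong to $l_n^q$. Let $(F_j)_{j\ge 0}$ and $(G_j)_{j\ge 0}$ be sequences in $\mathbb{C}^{n\times n}$ with $$\sup_{j\ge 0}\|F_j\|<\infty,\qquad \sup_{j\ge 0}\|G_j\|<\infty .$$ Then all solutions $u$ of the perturbed equation $$A_{j,j-1}u_{j-1}+A_{j,j}u_j+A_{j,j+1}u_{j+1}=F_ju_j,\qquad j\ge 0,$$ belong to $l_n^p$, and all solutions $v$ of the perturbed equation $$v_{j-1}^{*}A_{j-1,j}+v_j^{*}A_{j,j}+v_{j+1}^{*}A_{j+1,j}=v_j^{*}G_j,\qquad j\ge 0,$$ belong to $l_n^q$.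
   Context: Fix $n\ge 1$. Let $A=(A_{i,j})_{i,j=0}^\infty$ be an infinite three-diagonal block matrix: each $A_{i,j}$ is an $n\times n$ complex matrix, $A_{i,j}=O$ (zero matrix) for $|i-j|>1$, and $A_{i+1,i}$, $A_{i,i+1}$ are invertible for all $i\ge 0$. In addition set $A_{0,-1}=A_{-1,0}=-E$, where $E$ is the $n\times n$ unit matrix. The unknowns $u_j,v_j\in\mathbb{C}^n$ ($j\ge -1$) are column vectors, and $*$ denotes Hermitian conjugation (so $v_j^*$ is a row vector). For $1\le p<\infty$, $l_n^p$ is the Banach space of sequences $u=(u_{-1},u_0,u_1,\dots)$ with $u_j\in\mathbb{C}^n$ and $\|u\|_p=(\sum_j|u_j|^p)^{1/p}<\infty$, where $|\cdot|$ is a fixed vector norm on $\mathbb{C}^n$; $l_n^\infty$ is the space of such sequences with $\|u\|_\infty=\sup_j|u_j|<\infty$. By convention $q=\infty$ if $p=1$ and $q=1$ if $p=\infty$. $\|\cdot\|$ is a matrix norm on $\mathbb{C}^{n\times n}$. *)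

(* Defs.v *)
(* The complex field is R[i] for an arbitrary R : realType. *)
From mathcomp Require Export all_boot all_order all_algebra.
From mathcomp Require Export complex spectral.
From mathcomp Require Export all_classical all_reals all_analysis.

Set Implicit Arguments.
Unset Strict Implicit.
Unset Printing Implicit Defensive.

Import Order.TTheory GRing.Theory Num.Theory.
Local Open Scope ring_scope.
Local Open Scope complex_scope.
Local Open Scope sesquilinear_scope.
Local Open Scope classical_set_scope.

Record is_norm (R : realType) (V : lmodType R[i]) (N : V -> R) : Prop := IsNorm {
  norm_nonneg : forall x, 0 <= N x;
  norm_definite : forall x, N x = 0 -> x = 0;
  norm_homogeneous : forall (a : R[i]) x, N (a *: x) = Normc.normc a * N x;
  norm_triangle : forall x y, N (x + y) <= N x + N y
}.

(* A i j is defined for i, j >= 0 only; the values A_{0,-1} and A_{-1,0} are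
   supplied by [blk] below. *)
Record block_tridiagonal (R : realType) (n : nat)
    (A : nat -> nat -> 'M[R[i]]_n) : Prop := BlockTridiagonal {
  tridiag_zero : forall i j : nat, (i.+1 < j)%N || (j.+1 < i)%N -> A i j = 0;
  tridiag_sub_unit : forall i : nat, A i.+1 i \in unitmx;
  tridiag_sup_unit : forall i : nat, A i i.+1 \in unitmx
}.

(* Shifted indices: [blk A i j] is A_{i-1,j-1}, with A_{0,-1} = A_{-1,0} = -E.
   The entry [blk A 0 0] (A_{-1,-1}) is a dummy that is never used. *)
Definition blk (R : realType) (n : nat) (A : nat -> nat -> 'M[R[i]]_n)
    (i j : nat) : 'M[R[i]]_n :=
  match i, j with
  | i'.+1, j'.+1 => A i' j'
  | 0%N, 1%N | 1%N, 0%N => - 1%:M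
  | _, _ => 0
  end.

(* A sequence (u_j)_{j >= -1} is a function u on nat with u k = u_{k-1}.
   [right_op A u j] is A_{j,j-1} u_{j-1} + A_{j,j} u_j + A_{j,j+1} u_{j+1}. *)
Definition right_op (R : realType) (n : nat) (A : nat -> nat -> 'M[R[i]]_n)
    (u : nat -> 'cV[R[i]]_n) (j : nat) : 'cV[R[i]]_n :=
  blk A j.+1 j *m u j + blk A j.+1 j.+1 *m u j.+1 + blk A j.+1 j.+2 *m u j.+2.

(* [left_op A v j] is v_{j-1}^* A_{j-1,j} + v_j^* A_{j,j} + v_{j+1}^* A_{j+1,j}. *)
Definition left_op (R : realType) (n : nat) (A : nat -> nat -> 'M[R[i]]_n)
    (v : nat -> 'cV[R[i]]_n) (j : nat) : 'rV[R[i]]_n :=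
  (v j)^t* *m blk A j j.+1 + (v j.+1)^t* *m blk A j.+1 j.+1
    + (v j.+2)^t* *m blk A j.+2 j.+1.

(* Only meaningful for 1 <= p; the value at -oo is a dummy. *)
Definition lp_norm (R : realType) (n : nat) (N : 'cV[R[i]]_n -> R) (p : \bar R)
    (u : nat -> 'cV[R[i]]_n) : \bar R :=
  match p with
  | r%:E => ((\sum_(0 <= k <oo) ((N (u k)) `^ r)%:E) `^ r^-1)%E
  | +oo%E => ereal_sup (range (fun k => (N (u k))%:E))
  | -oo%E => +oo%E
  end.

Definition in_lp (R : realType) (n : nat) (N : 'cV[R[i]]_n -> R) (p : \bar R)
    (u : nat -> 'cV[R[i]]_n) : Prop := (lp_norm N p u < +oo)%E.

(* Main.v *)
From mathcomp Require Import ring.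
Require Import Defs.

Set Implicit Arguments.
Unset Strict Implicit.
Unset Printing Implicit Defensive.

Import Order.TTheory GRing.Theory Num.Theory.
Import numFieldNormedType.Exports.
Local Open Scope ring_scope.
Local Open Scope complex_scope.
Local Open Scope sesquilinear_scope.
Local Open Scope classical_set_scope.

(** The proof is variation of constants followed by Gronwall's inequality.

    Shift the indices so that sequences start at 0, and write
    B_{j,k} = A_{j-1,k-1} for the blocks and L for the right operator.  The
    Wronskian W_j(V, U) = V_j B_{j,j+1} U_{j+1} - V_{j+1} B_{j+1,j} U_j
    of a sequence V of rows and a sequence U of columns satisfies a discrete
    Lagrange identity ([lagrange_identity]): when V solves the unperturbed left
    equation, W_{j+1}(V, u) = W_j(V, u) + V_{j+1} (L u)_j.  In particular W is
    constant on pairs of unperturbed solutions.  Since the off-diagonal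
    blocks are invertible, the initial data can be chosen so that a full system
    U of 2n right solutions and a full system V of 2n left solutions have
    W_j(V, U) = 1 for every j ([dual_fundamental_pair]).  As W_j(V, U) is
    then the product of three square matrices of size 2n, of which the last is the state
    (U_j, U_{j+1}), this left inverse of the state is also a right inverse,
    which recovers an arbitrary sequence u from its Wronskian
    ([wronskian_reconstruction]): u_j = U_j W_j(V, u) and
    u_{j+1} = U_{j+1} W_j(V, u).

    If L u = F u, summing the Lagrange identity gives
      u_{j+1} = U_{j+1} (W_0(V, u) + \sum_(k < j) V_{k+1} F_k u_{k+1}).
    Let a_j and b_j be the sums of the norms of the columns of U_j and of the
    adjoints of the rows of V_j; then a is in l^p and b in l^q by hypothesis, and taking norms
      |u_j| <= a_j (K + D \sum_(k < j) b_k |u_k|).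
    The product a b is summable because 1/p + 1/q = 1
    ([lp_seq_mul_summable]), so Gronwall's inequality ([discrete_gronwall])
    bounds |u_j| by a constant multiple of a_j, and u is in l^p.

    Passing from norms of vectors and of the F_j to moduli of entries uses that
    norms on matrices dominate the entries ([norm_entry_bound]), a consequence
    of the compactness of spheres in R^d.

    The claim on the left equation is the claim on the right equation for the
    adjoint operator, whose blocks are (A_{j,i})^*, with p and q exchanged. *)

Local Notation normc := Normc.normc.

(** * Norms on complex matrices *)

Lemma normc_ge0 (R : rcfType) (z : R[i]) : 0 <= normc z.
Proof. by case: z => a b; exact: sqrtr_ge0. Qed.

Lemma normc_conj (R : rcfType) (z : R[i]) : normc (Num.conj z) = normc z.
Proof. by case: z => a b /=; rewrite sqrrN. Qed.

Lemma normc_real (R : rcfType) (a : R) : normc a%:C = `|a|.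
Proof. by rewrite /= expr0n addr0 sqrtr_sqr. Qed.

Lemma normc_le_ReIm (R : rcfType) (z : R[i]) :
  normc z <= `|complex.Re z| + `|complex.Im z|.
Proof.
case: z => a b /=.
rewrite -[leRHS]ger0_norm ?addr_ge0// -[leRHS]sqrtr_sqr ler_wsqrtr//.
rewrite sqrrD !real_normK ?num_real// addrAC lerDl.
by rewrite mulrn_wge0// mulr_ge0.
Qed.

Lemma normc_sum (R : realType) (I : Type) (r : seq I) (f : I -> R[i]) :
  normc (\sum_(i <- r) f i) <= \sum_(i <- r) normc (f i).
Proof.
elim/big_ind2: _ => //[|x x' y y' hx hy]; first by rewrite Normc.normc0.
by apply: (le_trans (le_normcD _ _)); exact: lerD.
Qed.

Lemma normc_mulmx (R : realType) (m n p : nat) (X : 'M[R[i]]_(m, n))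
    (Y : 'M[R[i]]_(n, p)) i k :
  normc ((X *m Y) i k) <= \sum_j normc (X i j) * normc (Y j k).
Proof.
rewrite mxE (le_trans (normc_sum _ _))// ler_sum// => j _.
by rewrite Normc.normcM.
Qed.

Lemma norm_zero (R : realType) (V : lmodType R[i]) (N : V -> R) :
  is_norm N -> N 0 = 0.
Proof.
by move=> hN; rewrite -(scale0r 0) (norm_homogeneous hN) Normc.normc0 mul0r.
Qed.

Lemma norm_sum (R : realType) (V : lmodType R[i]) (N : V -> R) (hN : is_norm N)
    (I : Type) (r : seq I) (f : I -> V) :
  N (\sum_(i <- r) f i) <= \sum_(i <- r) N (f i).
Proof.
elim/big_ind2: _ => //[|x x' y y' hx hy]; first by rewrite (norm_zero hN).
by apply: (le_trans (norm_triangle hN _ _)); exact: lerD.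
Qed.

(** The sup-norm unit sphere is compact and f, being Lipschitz for the sup norm,
    attains on it a minimum, which is positive by definiteness; C is its
    inverse. *)
Lemma real_norm_ge_sup_norm (R : realType) (d : nat) (f : 'rV[R]_d -> R) :
  (forall x, 0 <= f x) -> (forall x, f x = 0 -> x = 0) ->
  (forall a x, f (a *: x) = `|a| * f x) ->
  (forall x y, f (x + y) <= f x + f y) ->
  exists2 C, 0 <= C & forall x, `|x| <= C * f x.
Proof.
move=> f_ge0 f_def fZ fD.
have f0 : f 0 = 0 by rewrite -(scale0r 0) fZ normr0 mul0r.
have f_sum (I : Type) (r : seq I) (g : I -> 'rV[R]_d) :
    f (\sum_(i <- r) g i) <= \sum_(i <- r) f (g i).
  elim/big_ind2: _ => //[|x x' y y' hx hy]; first by rewrite f0.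
  by apply: (le_trans (fD _ _)); exact: lerD.
pose K := \sum_i f (delta_mx 0 i).
have K_ge0 : 0 <= K by apply: sumr_ge0.
have coord (x : 'rV[R]_d) i : `|x 0 i| <= `|x|.
  by rewrite [leRHS]/Num.norm /= mx_normrE; apply/bigmax_geP; right => /=; exists (0, i).
have f_le x : f x <= K * `|x|.
  rewrite [x in f x]row_sum_delta (le_trans (f_sum _ _ _))// mulr_suml ler_sum// => i _.
  by rewrite fZ mulrC ler_wpM2l.
have fB x y : `|f x - f y| <= K * `|x - y|.
  have h a b : f a - f b <= K * `|a - b|.
    by rewrite lerBlDr (le_trans _ (lerD (f_le _) (lexx _)))// -{1}(subrK b a).
  by rewrite ler_norml h andbT lerNl opprB distrC h.
have f_cont : continuous f.
  move=> x; apply/(@cvgrPdist_le _ _ _ (nbhs x)) => e e0.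
  near=> y.
  rewrite (le_trans (fB _ _))//.
  rewrite (@le_trans _ _ ((K + 1) * `|x - y|))//; first by rewrite ler_wpM2r// lerDl.
  rewrite mulrC -ler_pdivlMr ?ltr_wpDl//.
  near: y; apply: cvgr_dist_le => //; rewrite divr_gt0// ltr_wpDl//.
pose S := [set x : 'rV[R]_d | `|x| = 1].
have normalized x : x != 0 -> S (`|x|^-1 *: x).
  by move=> x0; rewrite /S /= normrZ normfV normr_id mulVf// normr_eq0.
(* The sphere is empty exactly when d = 0. *)
have [[s Ss]|S0] := pselect (S !=set0); last first.
  exists 0 => // x; have [->|x0] := eqVneq x 0; first by rewrite normr0 mul0r.
  by case: S0; exists (`|x|^-1 *: x); exact: normalized.
have S_compact : compact S.
  apply: bounded_closed_compact.
    by exists 1; split => // M M1 x /= ->; exact: ltW.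
  have -> : S = (fun x : 'rV[R]_d => `|x|) @^-1` [set 1] by [].
  apply: closed_comp => [x _|]; first exact: norm_continuous.
  exact: closed_eq.
have [c cS cmin] := EVT_min_rV (ex_intro _ s Ss) S_compact (continuous_subspaceT f_cont).
have c_neq0 : c != 0.
  by apply/eqP => c0; move: cS; rewrite inE /S /= c0 normr0 => /esym/eqP; rewrite oner_eq0.
have fc_gt0 : 0 < f c.
  by rewrite lt_def f_ge0 andbT; apply/eqP => /f_def/eqP; exact/negP.
exists (f c)^-1 => [|x]; first by rewrite invr_ge0.
have [->|x0] := eqVneq x 0; first by rewrite normr0 mulr_ge0// invr_ge0.
have := cmin _ (mem_set (normalized _ x0)).
rewrite fZ normfV normr_id mulrC ler_pdivlMr ?normr_gt0// => h.
by rewrite mulrC ler_pdivlMr// mulrC.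
Unshelve. all: by end_near.
Qed.

(** The estimate is that of [real_norm_ge_sup_norm] in the real coordinates that
    encode a matrix by the row of its real parts followed by its imaginary parts. *)
Lemma norm_entry_bound (R : realType) (m n : nat) (N : 'M[R[i]]_(m, n) -> R) :
  is_norm N ->
  exists2 C, 0 <= C & forall (X : 'M[R[i]]_(m, n)) i j, normc (X i j) <= C * N X.
Proof.
move=> hN.
pose L (x : 'rV[R]_(m * n + m * n)) : 'M[R[i]]_(m, n) :=
  \matrix_(i, j) (x 0 (lshift _ (mxvec_index i j))
                  +i* x 0 (rshift _ (mxvec_index i j))).
have [| | | |C C0 hC] := @real_norm_ge_sup_norm R _ (fun x => N (L x)).
- by move=> x; exact: norm_nonneg.
- move=> x /(norm_definite hN) /matrixP Lx; apply/rowP => k.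
  rewrite mxE; case: (splitP k) => l kl.
    have -> : k = lshift _ l by exact: val_inj.
    by case/mxvec_indexP: l {kl} => i j; have := Lx i j; rewrite !mxE => -[].
  have -> : k = rshift _ l by exact: val_inj.
  by case/mxvec_indexP: l {kl} => i j; have := Lx i j; rewrite !mxE => -[].
- move=> a x; rewrite -normc_real -(norm_homogeneous hN); congr N.
  by apply/matrixP => i j; rewrite !mxE; simpc.
- move=> x y; apply: le_trans (norm_triangle hN _ _).
  rewrite le_eqVlt; apply/orP; left; apply/eqP; congr N.
  by apply/matrixP => i j; rewrite !mxE; simpc.
exists (2 * C) => [|X i j]; first by rewrite mulr_ge0.
pose x := row_mx (mxvec (map_mx (@complex.Re R) X)) (mxvec (map_mx (@complex.Im R) X)).
have LX : L x = X.
  by apply/matrixP => k l; rewrite mxE row_mxEl row_mxEr !mxvecE !mxE; case: (X k l).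
have coord k : `|x 0 k| <= `|x|.
  by rewrite [leRHS]/Num.norm /= mx_normrE; apply/bigmax_geP; right => /=; exists (0, k).
have := hC x; rewrite LX -mulrA mulr2n mulrDl mul1r => hX.
apply: (le_trans (normc_le_ReIm _)); apply: lerD; apply: le_trans hX.
  by have := coord (lshift _ (mxvec_index i j)); rewrite row_mxEl mxvecE mxE.
by have := coord (rshift _ (mxvec_index i j)); rewrite row_mxEr mxvecE mxE.
Qed.

(** * Nonnegative sequences: lp bounds and Gronwall's inequality *)

Section Sequences.
Variable R : realType.
Implicit Types (p q : \bar R) (a b : nat -> R).

(** For nonnegative sequences and p >= 1 this is membership in l^p, stated with
    bounds on partial sums in R instead of series in the extended reals. *)
Definition lp_seq p a : Prop :=
  match p with
  | r%:E => exists B, forall m, \sum_(k < m) (a k) `^ r <= B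
  | +oo%E => exists B, forall k, a k <= B
  | -oo%E => False
  end.

Lemma in_lpE (n : nat) (N : 'cV[R[i]]_n -> R) p u : (1 <= p)%E ->
  in_lp N p u <-> lp_seq p (fun k => N (u k)).
Proof.
case: p => [r| |]; rewrite /in_lp /= ?lee_fin => r1 //; last first.
  split => [h|[B hB]].
    set s := ereal_sup _ in h.
    have ub k : ((N (u k))%:E <= s)%E by apply: ereal_sup_ubound; exists k.
    have s_fin : s \is a fin_num.
      by rewrite fin_numElt h andbT (lt_le_trans _ (ub 0%N))// ltNyr.
    by exists (fine s) => k; rewrite -lee_fin fineK.
  apply: (@le_lt_trans _ _ B%:E); last exact: ltry.
  by apply: ge_ereal_sup => _ [k _ <-]; rewrite lee_fin.
have r0 : r != 0 by rewrite gt_eqF// (lt_le_trans ltr01).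
have ge0 k : xpredT k -> (0 <= ((N (u k)) `^ r)%:E)%E by rewrite lee_fin powR_ge0.
set s := (\sum_(0 <= k <oo) _)%E.
have -> : (s `^ r^-1 < +oo)%E = (s < +oo)%E.
  apply/idP/idP; last by exact: poweR_lty.
  by rewrite !ltey; apply: contra_neq => ->; rewrite poweRyr// invr_neq0.
have s_ge0 : (0 <= s)%E by apply: nneseries_ge0 => k _ _; exact: ge0.
split => [h|[B hB]].
  exists (fine s) => m; rewrite -lee_fin fineK ?ge0_fin_numE// -sumEFin.
  rewrite -(big_mkord xpredT (fun k => ((N (u k)) `^ r)%:E)).
  by apply: nneseries_lim_ge => k _ _; exact: ge0.
apply: (@le_lt_trans _ _ B%:E); last exact: ltry.
apply: lime_le; first by apply: is_cvg_nneseries => k _ _; exact: ge0.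
by apply: nearW => m; rewrite big_mkord sumEFin lee_fin; exact: hB.
Qed.

Lemma lp_seq_le p a b : (1 <= p)%E -> (forall k, 0 <= a k <= b k) ->
  lp_seq p b -> lp_seq p a.
Proof.
case: p => [r| |] //=; rewrite ?lee_fin => r1 ab [B hB]; exists B; last first.
  by move=> k; have /andP[_ h] := ab k; exact: le_trans h (hB k).
move=> m; apply: le_trans (hB m); apply: ler_sum => k _; have /andP[a0 ab'] := ab k.
by rewrite ge0_ler_powR ?nnegrE ?(le_trans ler01 r1) ?(le_trans a0 ab').
Qed.

Lemma lp_seqZ p a c : 0 <= c -> (forall k, 0 <= a k) ->
  lp_seq p a -> lp_seq p (fun k => c * a k).
Proof.
case: p => [r| |] //= c0 a0 [B hB].
  exists (c `^ r * B) => m; under eq_bigr do rewrite powRM//.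
  by rewrite -mulr_sumr ler_wpM2l ?powR_ge0.
by exists (c * B) => k; rewrite ler_wpM2l.
Qed.

Lemma lp_seqD p a b : (1 <= p)%E ->
  (forall k, 0 <= a k) -> (forall k, 0 <= b k) ->
  lp_seq p a -> lp_seq p b -> lp_seq p (fun k => a k + b k).
Proof.
case: p => [r| |] //=; rewrite ?lee_fin => r1 a0 b0 [B hB] [B' hB']; last first.
  by exists (B + B') => k; exact: lerD.
exists (2 `^ r * (B + B')) => m.
apply: (@le_trans _ _ (\sum_(k < m) 2 `^ r * (a k `^ r + b k `^ r))); last first.
  by rewrite -mulr_sumr ler_wpM2l ?powR_ge0// big_split /= lerD.
have r0 : 0 <= r by rewrite (le_trans ler01).
(* a + b is at most twice the larger of a and b. *)
apply: ler_sum => k _; rewrite mulrDr -!powRM//.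
have [ab|/ltW ba] := leP (a k) (b k).
  apply: (@le_trans _ _ ((2 * b k) `^ r)); last by rewrite lerDr powR_ge0.
  by rewrite ge0_ler_powR ?nnegrE ?addr_ge0 ?mulr_ge0// mulr2n mulrDl mul1r lerD.
apply: (@le_trans _ _ ((2 * a k) `^ r)); last by rewrite lerDl powR_ge0.
by rewrite ge0_ler_powR ?nnegrE ?addr_ge0 ?mulr_ge0// mulr2n mulrDl mul1r lerD.
Qed.

Lemma lp_seq_sum p (I : Type) (s : seq I) (a : I -> nat -> R) : (1 <= p)%E ->
  (forall i k, 0 <= a i k) -> (forall i, lp_seq p (a i)) ->
  lp_seq p (fun k => \sum_(i <- s) a i k).
Proof.
move=> p1 a0 ha; elim: s => [|i s IH].
  case: p p1 {ha} => [r| |] //=; rewrite ?lee_fin => r1; exists 0; last first.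
    by move=> k; rewrite big_nil.
  by move=> m; rewrite big1// => k _; rewrite big_nil powR0// gt_eqF// (lt_le_trans ltr01).
apply: (@lp_seq_le _ _ (fun k => a i k + \sum_(j <- s) a j k)) => //.
  by move=> k; rewrite big_cons lexx andbT addr_ge0// sumr_ge0.
by apply: lp_seqD => // k; rewrite sumr_ge0.
Qed.

Lemma conj_exponent_ge1 p q : (1 <= p)%E -> (p^-1 + q^-1 = 1)%E -> (1 <= q)%E.
Proof.
case: p => [r| |] //=; rewrite ?lee_fin => r1; last first.
  by rewrite invey add0e => /eqP; rewrite inve_eq1 => /eqP ->.
have r0 : 0 < r := lt_le_trans ltr01 r1.
rewrite inver gt_eqF//; case: (inveP q) => [||//|s s0].
- by [].
- by rewrite leey.
rewrite -EFinD => -[h]; rewrite lee_fin.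
have s_gt0 : 0 < s.
  rewrite -invr_gt0 lt_def invr_neq0//=.
  have -> : s^-1 = 1 - r^-1 by rewrite -h addrAC subrr add0r.
  by rewrite subr_ge0 invf_le1.
by rewrite -invf_le1// -h lerDr invr_ge0 ltW.
Qed.

(** The qualitative part of Hoelder's inequality: summability comes from Young's
    inequality when both exponents are finite, and from a bound on one factor
    when the other is summable. *)
Lemma lp_seq_mul_summable p q a b : (1 <= p)%E -> (p^-1 + q^-1 = 1)%E ->
  (forall k, 0 <= a k) -> (forall k, 0 <= b k) ->
  lp_seq p a -> lp_seq q b ->
  exists B, forall m, \sum_(k < m) a k * b k <= B.
Proof.
have l1oo c d : (forall k, 0 <= c k) -> lp_seq 1 c -> lp_seq +oo d ->
    exists B, forall m, \sum_(k < m) c k * d k <= B.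
  move=> c0 [B hB] [D hD]; have D_ge0 : 0 <= Num.max 0 D by rewrite le_max lexx.
  exists (B * Num.max 0 D) => m; apply: (@le_trans _ _ (\sum_(k < m) c k * Num.max 0 D)).
    by apply: ler_sum => k _; rewrite ler_wpM2l// le_max hD orbT.
  rewrite -mulr_suml ler_wpM2r//; apply: le_trans (hB m).
  by apply: ler_sum => k _; rewrite powRr1.
move=> p1 pq a0 b0.
have q1 := conj_exponent_ge1 p1 pq.
case: p q p1 pq q1 => [r| |] [s| |] //=; rewrite ?lee_fin => r1 + s1.
- rewrite !inver !gt_eqF ?(lt_le_trans ltr01)// -EFinD => -[rs] [B hB] [D hD].
  have r0 := lt_le_trans ltr01 r1; have s0 := lt_le_trans ltr01 s1.
  exists (B / r + D / s) => m.
  apply: (@le_trans _ _ (\sum_(k < m) (a k `^ r / r + b k `^ s / s))).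
    by apply: ler_sum => k _; exact: conjugate_powR.
  by rewrite big_split/= -!mulr_suml lerD// ler_wpM2r// invr_ge0 ltW.
- by rewrite invey adde0 => /eqP; rewrite inve_eq1 => /eqP[->]; exact: l1oo.
- rewrite invey add0e => /eqP; rewrite inve_eq1 => /eqP[->] ha hb.
  have [B hB] := l1oo b a b0 hb ha.
  by exists B => m; apply: le_trans (hB m); apply: ler_sum => k _; rewrite mulrC.
- by rewrite !invey adde0 => /esym/eqP; rewrite onee_eq0.
Qed.

(** The factor y_j that multiplies a_j in the last hypothesis satisfies
    y_{j+1} <= (1 + a_j b_j) y_j, hence grows at most like the exponential of
    the partial sums of a b. *)
Lemma discrete_gronwall (a b x : nat -> R) (K B : R) :
  0 <= K -> (forall k, 0 <= a k) -> (forall k, 0 <= b k) ->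
  (forall m, \sum_(k < m) a k * b k <= B) ->
  (forall j, x j <= a j * (K + \sum_(k < j) b k * x k)) ->
  forall j, x j <= K * expR B * a j.
Proof.
move=> K0 a0 b0 hB hx j.
have y_le : K + \sum_(k < j) b k * x k <= K * expR (\sum_(k < j) a k * b k).
  elim: j => [|j IH]; first by rewrite !big_ord0 expR0 mulr1 addr0.
  rewrite !big_ord_recr /= addrA expRD mulrA.
  set y := K + _ in IH *; set e := K * _ in IH *.
  have e0 : 0 <= e by rewrite mulr_ge0// expR_ge0.
  apply: (@le_trans _ _ (e * (1 + a j * b j))); last by rewrite ler_wpM2l// expR_ge1Dx.
  rewrite mulrDr mulr1 lerD// mulrA mulrC ler_wpM2r// (le_trans (hx j))//.
  by rewrite mulrC ler_wpM2r.
apply: (le_trans (hx j)); rewrite mulrC ler_wpM2r// (le_trans y_le)//.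
by rewrite ler_wpM2l// ler_expR.
Qed.
End Sequences.

(** * The Wronskian and variation of constants *)

Lemma second_order_recursion (T : Type) (step : nat -> T -> T -> T) (x0 x1 : T) :
  exists u : nat -> T,
    [/\ u 0%N = x0, u 1%N = x1 & forall j, u j.+2 = step j (u j) (u j.+1)].
Proof.
pose st := fix st k := match k with
  | 0%N => (x0, x1)
  | j.+1 => let: (x, y) := st j in (y, step j x y) end.
exists (fun k => (st k).1); split => // j /=.
by case: (st j) => x y.
Qed.

Section Wronskian.
Variables (R : realType) (n : nat) (A : nat -> nat -> 'M[R[i]]_n).

Lemma blkSS i j : blk A i.+1 j.+1 = A i j.
Proof. by case: i. Qed.

(** The extension of [right_op] to matrices, so that several solutions can be
    stored as the columns of one sequence. *)
Definition right_mx (b : nat) (U : nat -> 'M[R[i]]_(n, b)) (j : nat) :=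
  blk A j.+1 j *m U j + blk A j.+1 j.+1 *m U j.+1 + blk A j.+1 j.+2 *m U j.+2.

(** Here the rows are the v_j^* themselves: [left_op A v] is [left_mx A] applied
    to the sequence of the conjugate transposes of v. *)
Definition left_mx (a : nat) (V : nat -> 'M[R[i]]_(a, n)) (j : nat) :=
  V j *m blk A j j.+1 + V j.+1 *m blk A j.+1 j.+1 + V j.+2 *m blk A j.+2 j.+1.

Definition wronskian (a b : nat) (V : nat -> 'M[R[i]]_(a, n))
    (U : nat -> 'M[R[i]]_(n, b)) (j : nat) : 'M[R[i]]_(a, b) :=
  V j *m blk A j j.+1 *m U j.+1 - V j.+1 *m blk A j.+1 j *m U j.

(** The diagonal blocks cancel between the two operators, and the four
    other terms are those of the two Wronskians. *)
Lemma lagrange_identity a b (V : nat -> 'M[R[i]]_(a, n))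
    (U : nat -> 'M[R[i]]_(n, b)) j :
  wronskian V U j.+1 =
  wronskian V U j + V j.+1 *m right_mx U j - left_mx V j *m U j.+1.
Proof.
have cancel (Z : zmodType) (x y z w d : Z) :
    x - y = z - w + (w + d + x) - (z + d + y).
  by rewrite !addrA subrK opprD addrA [z + d + x]addrC addrK.
by rewrite /wronskian /right_mx /left_mx !mulmxDr !mulmxDl !mulmxA; exact: cancel.
Qed.

Lemma wronskian_telescope a b (V : nat -> 'M[R[i]]_(a, n))
    (U : nat -> 'M[R[i]]_(n, b)) :
  (forall j, left_mx V j = 0) ->
  forall k, wronskian V U k =
    wronskian V U 0 + \sum_(j < k) V j.+1 *m right_mx U j.
Proof.
move=> hV; elim=> [|k IH]; first by rewrite big_ord0 addr0.
by rewrite lagrange_identity IH hV mul0mx subr0 big_ord_recr/= addrA.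
Qed.

Lemma wronskian_block a b (V : nat -> 'M[R[i]]_(a, n))
    (U : nat -> 'M[R[i]]_(n, b)) j :
  wronskian V U j =
  row_mx (V j) (V j.+1) *m block_mx 0 (blk A j j.+1) (- blk A j.+1 j) 0
    *m col_mx (U j) (U j.+1).
Proof.
by rewrite mul_row_block mul_row_col !mulmx0 add0r addr0 mulmxN mulNmx addrC.
Qed.

(** By [wronskian_block] the hypothesis says that T J S = 1, where S is the state
    (U_j, U_{j+1}) and T J has the same size 2n; hence S (T J) = 1, and applying
    this to the state (u_j, u_{j+1}) gives both equations. *)
Lemma wronskian_reconstruction b (V : nat -> 'M[R[i]]_(n + n, n))
    (U : nat -> 'M[R[i]]_(n, n + n)) (u : nat -> 'M[R[i]]_(n, b)) j :
  wronskian V U j = 1%:M ->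
  u j = U j *m wronskian V u j /\ u j.+1 = U j.+1 *m wronskian V u j.
Proof.
rewrite !wronskian_block => /mulmx1C VU1.
apply: eq_col_mx; rewrite -mul_col_mx.
by rewrite !mulmxA in VU1 *; rewrite VU1 mul1mx.
Qed.

Lemma right_mx_solution (hA : block_tridiagonal A) b (X0 X1 : 'M[R[i]]_(n, b)) :
  exists U, [/\ U 0%N = X0, U 1%N = X1 & forall j, right_mx U j = 0].
Proof.
have [U [U0 U1 hU]] := second_order_recursion (fun j X Y =>
  - (invmx (blk A j.+1 j.+2) *m (blk A j.+1 j *m X + blk A j.+1 j.+1 *m Y))) X0 X1.
exists U; split => // j; rewrite /right_mx hU mulmxN mulmxA mulmxV ?mul1mx ?subrr//.
by rewrite blkSS; exact: tridiag_sup_unit.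
Qed.

Lemma left_mx_solution (hA : block_tridiagonal A) a (X0 X1 : 'M[R[i]]_(a, n)) :
  exists V, [/\ V 0%N = X0, V 1%N = X1 & forall j, left_mx V j = 0].
Proof.
have [V [V0 V1 hV]] := second_order_recursion (fun j X Y =>
  - ((X *m blk A j j.+1 + Y *m blk A j.+1 j.+1) *m invmx (blk A j.+2 j.+1))) X0 X1.
exists V; split => // j; rewrite /left_mx hV mulNmx -mulmxA mulVmx ?mulmx1 ?subrr//.
by rewrite blkSS; exact: tridiag_sub_unit.
Qed.

(** The Wronskian of two families of solutions is constant, so only its initial
    value matters.  With the initial state of U equal to the identity, the
    initial values of V are the blocks of the inverse of the coefficient matrix,
    which is explicit because A_{0,-1} = A_{-1,0} = -E. *)
Lemma dual_fundamental_pair (hA : block_tridiagonal A) :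
  exists (U : nat -> 'M[R[i]]_(n, n + n)) (V : nat -> 'M[R[i]]_(n + n, n)),
    [/\ forall j, right_mx U j = 0, forall j, left_mx V j = 0 &
        forall j, wronskian V U j = 1%:M].
Proof.
have [U [U0 U1 hU]] := right_mx_solution hA (row_mx 1%:M 0) (row_mx 0 1%:M).
have [V [V0 V1 hV]] := left_mx_solution hA (col_mx 0 (- 1%:M)) (col_mx 1%:M 0).
exists U, V; split => // j; rewrite wronskian_telescope// big1; last first.
  by move=> i _; rewrite hU mulmx0.
rewrite addr0 /wronskian U0 U1 V0 V1 /= !mulmxN !mulmx1 !mulNmx opprK -mulNmx.
rewrite opp_col_mx oppr0 opprK !mul_col_row add_block_mx.
by rewrite !mul0mx !mulmx0 mulmx1 !add0r addr0 -scalar_mx_block.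
Qed.

End Wronskian.

(** * The perturbed right equation *)

Definition l1_norm (R : realType) (m : nat) (w : 'cV[R[i]]_m) : R :=
  \sum_i normc (w i 0).

Lemma l1_norm_ge0 (R : realType) (m : nat) (w : 'cV[R[i]]_m) : 0 <= l1_norm w.
Proof. by apply: sumr_ge0 => i _; exact: normc_ge0. Qed.

Lemma l1_normD (R : realType) (m : nat) (v w : 'cV[R[i]]_m) :
  l1_norm (v + w) <= l1_norm v + l1_norm w.
Proof.
by rewrite -big_split ler_sum// => i _; rewrite mxE le_normcD.
Qed.

Lemma l1_norm_sum (R : realType) (m : nat) (I : Type) (r : seq I)
    (f : I -> 'cV[R[i]]_m) :
  l1_norm (\sum_(k <- r) f k) <= \sum_(k <- r) l1_norm (f k).
Proof.
elim/big_ind2: _ => //[|x x' y y' hx hy].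
  by rewrite /l1_norm big1// => i _; rewrite mxE Normc.normc0.
by apply: (le_trans (l1_normD _ _)); exact: lerD.
Qed.

Lemma norm_mulmx_le (R : realType) (n m : nat) (N : 'cV[R[i]]_n -> R)
    (hN : is_norm N) (X : 'M[R[i]]_(n, m)) (w : 'cV[R[i]]_m) :
  N (X *m w) <= (\sum_i N (col i X)) * l1_norm w.
Proof.
have -> : X *m w = \sum_i w i 0 *: col i X.
  apply/colP => k; rewrite mxE summxE; apply: eq_bigr => i _.
  by rewrite !mxE mulrC.
apply: (le_trans (norm_sum hN _ _)); rewrite mulr_suml ler_sum// => i _.
rewrite (norm_homogeneous hN) mulrC ler_wpM2l ?(norm_nonneg hN)//.
rewrite /l1_norm (bigD1 i)//= lerDl sumr_ge0// => l _; exact: normc_ge0.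
Qed.

Lemma l1_norm_mulmx3 (R : realType) (n m : nat) (N : 'cV[R[i]]_n -> R)
    (C M : R) (V : 'M[R[i]]_(m, n)) (F : 'M[R[i]]_n) (u : 'cV[R[i]]_n) :
  is_norm N -> 0 <= C -> (forall (x : 'cV[R[i]]_n) i j, normc (x i j) <= C * N x) ->
  0 <= M -> (forall i j, normc (F i j) <= M) ->
  l1_norm (V *m (F *m u)) <=
  n%:R * C * (n%:R * (M * C)) * (\sum_i N ((row i V)^t*)) * N u.
Proof.
move=> hN C0 hC M0 hF.
have Fu l : normc ((F *m u) l 0) <= n%:R * (M * C) * N u.
  apply: le_trans (normc_mulmx _ _ _ _) _.
  apply: (@le_trans _ _ (\sum_(k < n) M * (C * N u))).
    by apply: ler_sum => k _; apply: ler_pM => //; exact: normc_ge0.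
  by rewrite sumr_const card_ord -[leLHS]mulr_natl !mulrA.
rewrite mulr_sumr mulr_suml ler_sum// => i _.
apply: le_trans (normc_mulmx _ _ _ _) _.
apply: (@le_trans _ _ (\sum_(l < n) (C * N ((row i V)^t*)) * (n%:R * (M * C) * N u))).
  apply: ler_sum => l _; apply: ler_pM => //; try exact: normc_ge0.
  by have := hC ((row i V)^t*) l 0; rewrite !mxE normc_conj.
rewrite sumr_const card_ord -[leLHS]mulr_natl.
by rewrite [leLHS](_ : _ = n%:R * C * (n%:R * (M * C)) * N ((row i V)^t*) * N u) //; ring.
Qed.

(** Variation of constants bounds N (u j) by a j times a constant plus a sum of
    b k * N (u k) over k < j, where a is in l^p and b in l^q; Gronwall's
    inequality concludes. *)
Lemma perturbed_right_lp (R : realType) (n : nat)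
    (N : 'cV[R[i]]_n -> R) (hN : is_norm N)
    (A : nat -> nat -> 'M[R[i]]_n) (hA : block_tridiagonal A)
    (p q : \bar R) (p_ge1 : (1 <= p)%E) (hpq : (p^-1 + q^-1 = 1)%E)
    (hu : forall u : nat -> 'cV[R[i]]_n,
        (forall j, right_op A u j = 0) -> in_lp N p u)
    (hv : forall v : nat -> 'cV[R[i]]_n,
        (forall j, left_op A v j = 0) -> in_lp N q v)
    (F : nat -> 'M[R[i]]_n) (M : R) (M_ge0 : 0 <= M)
    (hF : forall k i j, normc (F k i j) <= M)
    (u : nat -> 'cV[R[i]]_n) (uF : forall j, right_op A u j = F j *m u j.+1) :
  in_lp N p u.
Proof.
have q_ge1 := conj_exponent_ge1 p_ge1 hpq.
have [U [V [hU hV W1]]] := dual_fundamental_pair hA.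
have [C C0 hC] := norm_entry_bound hN.
pose a k := \sum_i N (col i (U k)).
pose b k := \sum_i N ((row i (V k))^t*).
have a_ge0 k : 0 <= a k by apply: sumr_ge0 => i _; exact: norm_nonneg.
have b_ge0 k : 0 <= b k by apply: sumr_ge0 => i _; exact: norm_nonneg.
have a_lp : lp_seq p a.
  apply: lp_seq_sum => [//|i k|i]; first exact: norm_nonneg.
  apply/(in_lpE N (fun k => col i (U k)) p_ge1)/hu => j.
  by rewrite /right_op !colE !mulmxA -!mulmxDl -/(right_mx A U j) hU mul0mx.
have b_lq : lp_seq q b.
  apply: lp_seq_sum => [//|i k|i]; first exact: norm_nonneg.
  apply/(in_lpE N (fun k => (row i (V k))^t*) q_ge1)/hv => j; rewrite /left_op !trmxCK.
  by rewrite -!row_mul -!raddfD -/(left_mx A V j) hV raddf0.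
pose D := n%:R * C * (n%:R * (M * C)).
have D_ge0 : 0 <= D by rewrite !mulr_ge0.
pose K := l1_norm (wronskian A V u 0).
have K_ge0 : 0 <= K by exact: l1_norm_ge0.
have wronskian_le j :
    l1_norm (wronskian A V u j) <= K + \sum_(k < j) D * b k.+1 * N (u k.+1).
  rewrite wronskian_telescope//; apply: (le_trans (l1_normD _ _)).
  rewrite lerD2l; apply: (le_trans (l1_norm_sum _ _)); apply: ler_sum => k _.
  have -> : right_mx A u k = F k *m u k.+1 by exact: uF.
  exact: l1_norm_mulmx3.
(* At time 0 the sum is empty; at time j+1 the reconstruction from
   the Wronskian at time j keeps u_{j+1} itself out of the sum. *)
have u_le j : N (u j) <= a j * (K + \sum_(k < j) D * b k * N (u k)).
  case: j => [|j].
    have [-> _] := wronskian_reconstruction u (W1 0%N).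
    by rewrite big_ord0 addr0; exact: norm_mulmx_le.
  have [_ ->] := wronskian_reconstruction u (W1 j).
  apply: (le_trans (norm_mulmx_le hN _ _)).
  apply: (ler_wpM2l (a_ge0 j.+1)).
  apply: (le_trans (wronskian_le j)).
  (* Reindexing k.+1 < j.+1 adds the nonnegative term of index 0. *)
  by rewrite lerD2l big_ord_recl lerDr !mulr_ge0// (norm_nonneg hN).
have [B hB] := lp_seq_mul_summable p_ge1 hpq a_ge0 b_ge0 a_lp b_lq.
have Db_ge0 k : 0 <= D * b k by exact: mulr_ge0.
have DB m : \sum_(k < m) a k * (D * b k) <= D * B.
  under eq_bigr do rewrite mulrCA.
  by rewrite -mulr_sumr ler_wpM2l.
apply/in_lpE => //.
apply: (@lp_seq_le _ _ _ (fun k => K * expR (D * B) * a k)) => // [k|].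
  rewrite (norm_nonneg hN) /=.
  exact: (discrete_gronwall K_ge0 a_ge0 Db_ge0 DB u_le).
by apply: lp_seqZ => //; rewrite mulr_ge0// expR_ge0.
Qed.

(** * The adjoint operator *)

Definition adjoint_blocks (R : realType) (n : nat)
    (A : nat -> nat -> 'M[R[i]]_n) (i j : nat) : 'M[R[i]]_n := (A j i)^t*.

Lemma trmxC_unit (R : realType) (n : nat) (X : 'M[R[i]]_n) :
  (X^t* \in unitmx) = (X \in unitmx).
Proof. by rewrite map_unitmx unitmx_tr. Qed.

Lemma trmxC_mul (R : realType) (m n p : nat) (X : 'M[R[i]]_(m, n))
    (Y : 'M[R[i]]_(n, p)) : (X *m Y)^t* = Y^t* *m X^t*.
Proof. by rewrite trmx_mul map_mxM. Qed.

Section Adjoint.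
Variables (R : realType) (n : nat) (A : nat -> nat -> 'M[R[i]]_n).

Lemma blk_adjoint i j : blk (adjoint_blocks A) i j = (blk A j i)^t*.
Proof.
have E0 : (0 : 'M[R[i]]_n)^t* = 0 by rewrite trmx0 map_mx0.
have E1 : (- 1%:M : 'M[R[i]]_n)^t* = - 1%:M.
  by rewrite linearN /= trmx1 map_mxN map_mx1.
by case: i j => [|[|i]] [|[|j]].
Qed.

Lemma right_op_adjoint v j :
  right_op (adjoint_blocks A) v j = (left_op A v j)^t*.
Proof.
rewrite /right_op /left_op !blk_adjoint !linearD /= !map_mxD.
by rewrite !trmxC_mul !trmxCK.
Qed.

Lemma left_op_adjoint u j :
  left_op (adjoint_blocks A) u j = (right_op A u j)^t*.
Proof.
rewrite /right_op /left_op !blk_adjoint !linearD /= !map_mxD.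
by rewrite !trmxC_mul.
Qed.

Lemma block_tridiagonal_adjoint :
  block_tridiagonal A -> block_tridiagonal (adjoint_blocks A).
Proof.
case=> h0 h1 h2; split=> [i j ij|i|i]; rewrite /adjoint_blocks ?trmxC_unit//.
by rewrite h0 ?trmx0 ?map_mx0// orbC.
Qed.
End Adjoint.

Lemma sup_norm_entry_bound (R : realType) (n : nat) (NM : 'M[R[i]]_n -> R)
    (F : nat -> 'M[R[i]]_n) :
  is_norm NM -> (ereal_sup (range (fun j => (NM (F j))%:E)) < +oo)%E ->
  exists2 M, 0 <= M & forall k i j, normc (F k i j) <= M.
Proof.
move=> hNM; set s := ereal_sup _ => s_lt.
have ub k : ((NM (F k))%:E <= s)%E by apply: ereal_sup_ubound; exists k.
have s_fin : s \is a fin_num.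
  by rewrite fin_numElt s_lt andbT (lt_le_trans _ (ub 0%N))// ltNyr.
have [C C0 hC] := norm_entry_bound hNM.
have NM_le k : NM (F k) <= fine s by rewrite -lee_fin fineK.
exists (C * fine s) => [|k i j].
  by rewrite mulr_ge0// (le_trans _ (NM_le 0%N))// (norm_nonneg hNM).
by apply: le_trans (hC _ i j) _; rewrite ler_wpM2l.
Qed.

(** * Stability under bounded perturbations *)

Theorem theorem2 (R : realType) (n : nat) (n_ge1 : (1 <= n)%N)
    (N : 'cV[R[i]]_n -> R) (hN : is_norm N)
    (NM : 'M[R[i]]_n -> R) (hNM : is_norm NM)
    (A : nat -> nat -> 'M[R[i]]_n) (hA : block_tridiagonal A)
    (p q : \bar R) (p_ge1 : (1 <= p)%E) (hpq : (p^-1 + q^-1 = 1)%E)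
    (hu : forall u : nat -> 'cV[R[i]]_n,
        (forall j : nat, right_op A u j = 0) -> in_lp N p u)
    (hv : forall v : nat -> 'cV[R[i]]_n,
        (forall j : nat, left_op A v j = 0) -> in_lp N q v)
    (F G : nat -> 'M[R[i]]_n)
    (hF : (ereal_sup (range (fun j => (NM (F j))%:E)) < +oo)%E)
    (hG : (ereal_sup (range (fun j => (NM (G j))%:E)) < +oo)%E) :
  (forall u : nat -> 'cV[R[i]]_n,
      (forall j : nat, right_op A u j = F j *m u j.+1) -> in_lp N p u) /\
  (forall v : nat -> 'cV[R[i]]_n,
      (forall j : nat, left_op A v j = (v j.+1)^t* *m G j) -> in_lp N q v).
Proof.
split=> [u uF|v vG].
  have [M M0 hM] := sup_norm_entry_bound hNM hF.
  exact: (perturbed_right_lp hN hA p_ge1 hpq hu hv M0 hM uF).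
have [M M0 hM] := sup_norm_entry_bound hNM hG.
have qp : (q^-1 + p^-1 = 1)%E by rewrite addeC.
apply: (@perturbed_right_lp _ _ _ hN _ (block_tridiagonal_adjoint hA) q p
  (conj_exponent_ge1 p_ge1 hpq) qp _ _ (fun j => (G j)^t*) M M0).
- move=> w hw; apply: hv => j.
  by rewrite -[LHS]trmxCK -right_op_adjoint hw trmx0 map_mx0.
- move=> w hw; apply: hu => j.
  by rewrite -[LHS]trmxCK -left_op_adjoint hw trmx0 map_mx0.
- by move=> k i j; rewrite !mxE normc_conj.
- by move=> j; rewrite right_op_adjoint vG trmxC_mul trmxCK.
Qed.
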